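(* Let $\mathbf C$ be a cancellative atomic Markov category with conditionals. Then extensional and contextual equivalence of combs in $\mathbf C$ coincide. Moreover, for all objects $A,A',B,B'$, computing the extension defines a bijection between (1) morphisms $f:A\otimes B'\to A'\otimes B$ that are non-signalling from $B'$ to $B$, and (2) contextual equivalence classes of combs $(A,A')\to(B,B')$.
   Context: A Markov category is a symmetric monoidal category $(\mathbf C,\otimes,I)$ in which every object $X$ carries a commutative comonoid $\Delta_X:X\to X\otimes X$, $\mathrm{del}_X:X\to I$, compatible with $\otimes$, and every $f:X\to Y$ satisfies $\mathrm{del}_Y\circ f=\mathrm{del}_X$. Naturality of $\Delta$ is not assumed. Coherence isomorphisms are suppressed. $\mathbf C$ has conditionals if for every $f:A\to X\otimes Y$ there is $f|_X:X\otimes A\to Y$ with $f=(\mathrm{id}_X\otimes f|_X)\circ(\Delta_X\otimes\mathrm{id}_A)\circ\big(((\mathrm{id}_X\otimes\mathrm{del}_Y)\circ f)\otimes\mathrm{id}_A\big)\circ\Delta_A$. For $p:A\to X$ and $f_1,f_2:W\otimes X\to Y$, write $f_1=_pf_2$ if $(f_1\otimes\mathrm{id}_X)\circ(\mathrm{id}_W\otimes(\Delta_X\circ p))=(f_2\otimes\mathrm{id}_X)\circ(\mathrm{id}_W\otimes(\Delta_X\circ p))$. For $p:A\to X$, $q:B\to X$ write $p\ll q$ if for all $W,Y$ and $f_1,f_2:W\otimes X\to Y$, $f_1=_qf_2$ implies $f_1=_pf_2$. $p:A\to X$ is atomic if $\Delta_X\circ p\ll p\otimes p$; $\mathbf C$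 is atomic if all its morphisms are. An object $W$ is cancellable if $\mathrm{del}_W\otimes f_1=\mathrm{del}_W\otimes f_2$ implies $f_1=f_2$ for all parallel $f_1,f_2$; $\mathbf C$ is cancellative if all objects are cancellable. A morphism $f:X\otimes W'\to Y\otimes W$ is non-signalling from $W'$ to $W$ if there is $f_s:X\to W$ with $(\mathrm{del}_Y\otimes\mathrm{id}_W)\circ f=f_s\otimes\mathrm{del}_{W'}$. A comb $C$ of type $(A,A')\to(B,B')$ is a triple $\langle f|g\rangle_E$ of an object $E$ and morphisms $f:A\to E\otimes B$, $g:E\otimes B'\to A'$. For $h:B\otimes K\to B'\otimes K'$, the comb insertion is $C[h]=(g\otimes\mathrm{id}_{K'})\circ(\mathrm{id}_E\otimes h)\circ(f\otimes\mathrm{id}_K):A\otimes K\to A'\otimes K'$. The extension of $C$ is $C[\mathrm{swap}_{B,B'}]:A\otimes B'\to A'\otimes B$. Two combs $C_1,C_2$ of the same type are extensionally equivalent if their extensions are equal, and contextually equivalent if $C_1[h]=C_2[h]$ for all $K,K'$ and all $h:B\otimes K\to B'\otimes K'$. *)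

(* Defs.v *)
From mathcomp Require Import ssreflect ssrfun.

Set Implicit Arguments.
Unset Strict Implicit.
Unset Printing Implicit Defensive.

Declare Scope cat_scope.
Delimit Scope cat_scope with cat.
Local Open Scope cat_scope.

Record category := Category {
  obj :> Type;
  hom : obj -> obj -> Type;
  idm : forall X, hom X X;
  compm : forall X Y Z, hom Y Z -> hom X Y -> hom X Z;
  compA : forall W X Y Z (h : hom Y Z) (g : hom X Y) (f : hom W X),
    compm h (compm g f) = compm (compm h g) f;
  comp1m : forall X Y (f : hom X Y), compm (idm Y) f = f;
  compm1 : forall X Y (f : hom X Y), compm f (idm X) = f
}.

Arguments hom {c} X Y.
Arguments idm {c} X.
Arguments compm {c X Y Z} g f : rename.

Notation "g ∘ f" := (compm g f) (at level 40, left associativity) : cat_scope.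

(* Not assumed strict: associators and unitors are explicit isomorphisms. *)
Record sym_mon_category := SymMonCategory {
  smc_category :> category;
  unitob : smc_category;
  tensor : smc_category -> smc_category -> smc_category;
  tensorm : forall X Y X' Y' : smc_category,
    hom X Y -> hom X' Y' -> hom (tensor X X') (tensor Y Y');
  assoc : forall X Y Z : smc_category,
    hom (tensor (tensor X Y) Z) (tensor X (tensor Y Z));
  assoc_inv : forall X Y Z : smc_category,
    hom (tensor X (tensor Y Z)) (tensor (tensor X Y) Z);
  lunit : forall X : smc_category, hom (tensor unitob X) X;
  lunit_inv : forall X : smc_category, hom X (tensor unitob X);
  runit : forall X : smc_category, hom (tensor X unitob) X;
  runit_inv : forall X : smc_category, hom X (tensor X unitob);
  swap : forall X Y : smc_category, hom (tensor X Y) (tensor Y X);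
  tensorm1 : forall X Y : smc_category,
    tensorm (idm X) (idm Y) = idm (tensor X Y);
  tensorm_comp : forall (X Y Z X' Y' Z' : smc_category)
    (g : hom Y Z) (f : hom X Y) (g' : hom Y' Z') (f' : hom X' Y'),
    tensorm (g ∘ f) (g' ∘ f') = tensorm g g' ∘ tensorm f f';
  assocK : forall X Y Z, assoc_inv X Y Z ∘ assoc X Y Z = idm _;
  assoc_invK : forall X Y Z, assoc X Y Z ∘ assoc_inv X Y Z = idm _;
  lunitK : forall X, lunit_inv X ∘ lunit X = idm _;
  lunit_invK : forall X, lunit X ∘ lunit_inv X = idm _;
  runitK : forall X, runit_inv X ∘ runit X = idm _;
  runit_invK : forall X, runit X ∘ runit_inv X = idm _;
  swapK : forall X Y, swap Y X ∘ swap X Y = idm _;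
  assoc_nat : forall (X X' Y Y' Z Z' : smc_category)
    (f : hom X X') (g : hom Y Y') (h : hom Z Z'),
    assoc X' Y' Z' ∘ tensorm (tensorm f g) h
    = tensorm f (tensorm g h) ∘ assoc X Y Z;
  lunit_nat : forall (X Y : smc_category) (f : hom X Y),
    lunit Y ∘ tensorm (idm unitob) f = f ∘ lunit X;
  runit_nat : forall (X Y : smc_category) (f : hom X Y),
    runit Y ∘ tensorm f (idm unitob) = f ∘ runit X;
  swap_nat : forall (X X' Y Y' : smc_category) (f : hom X X') (g : hom Y Y'),
    swap X' Y' ∘ tensorm f g = tensorm g f ∘ swap X Y;
  pentagon : forall W X Y Z : smc_category,
    assoc W X (tensor Y Z) ∘ assoc (tensor W X) Y Z
    = tensorm (idm W) (assoc X Y Z) ∘ assoc W (tensor X Y) Z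
        ∘ tensorm (assoc W X Y) (idm Z);
  triangle : forall X Y : smc_category,
    tensorm (idm X) (lunit Y) ∘ assoc X unitob Y = tensorm (runit X) (idm Y);
  hexagon : forall X Y Z : smc_category,
    assoc Y Z X ∘ swap X (tensor Y Z) ∘ assoc X Y Z
    = tensorm (idm Y) (swap X Z) ∘ assoc Y X Z ∘ tensorm (swap X Y) (idm Z)
}.

Arguments unitob {s}.
Arguments tensor {s} X Y.
Arguments tensorm {s X Y X' Y'} f g : rename.
Arguments assoc {s} X Y Z.
Arguments assoc_inv {s} X Y Z.
Arguments lunit {s} X.
Arguments lunit_inv {s} X.
Arguments runit {s} X.
Arguments runit_inv {s} X.
Arguments swap {s} X Y.

Notation "X ⊗ Y" := (tensor X Y) (at level 38, right associativity) : cat_scope.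
Notation "f ⊗₁ g" := (tensorm f g) (at level 38, right associativity) : cat_scope.

Definition middle_swap (C : sym_mon_category) (X Y : C) :
    hom ((X ⊗ X) ⊗ (Y ⊗ Y)) ((X ⊗ Y) ⊗ (X ⊗ Y)) :=
  assoc_inv X Y (X ⊗ Y)
  ∘ (idm X ⊗₁ (assoc Y X Y ∘ (swap X Y ⊗₁ idm Y) ∘ assoc_inv X Y Y))
  ∘ assoc X X (Y ⊗ Y).

(* copy_tensor, del_tensor, copy_unit and del_unit say that the comonoids are
   compatible with the monoidal structure; the two unit laws are redundant.
   Naturality is required of del only. *)
Record markov_category := MarkovCategory {
  markov_smc :> sym_mon_category;
  copy : forall X : markov_smc, hom X (X ⊗ X);
  del : forall X : markov_smc, hom X unitob;
  copyA : forall X,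
    assoc X X X ∘ (copy X ⊗₁ idm X) ∘ copy X = (idm X ⊗₁ copy X) ∘ copy X;
  copyC : forall X, swap X X ∘ copy X = copy X;
  copy_dell : forall X, lunit X ∘ (del X ⊗₁ idm X) ∘ copy X = idm X;
  copy_delr : forall X, runit X ∘ (idm X ⊗₁ del X) ∘ copy X = idm X;
  copy_tensor : forall X Y,
    copy (X ⊗ Y) = middle_swap X Y ∘ (copy X ⊗₁ copy Y);
  del_tensor : forall X Y, del (X ⊗ Y) = lunit unitob ∘ (del X ⊗₁ del Y);
  copy_unit : copy unitob = lunit_inv unitob;
  del_unit : del unitob = idm unitob;
  del_nat : forall (X Y : markov_smc) (f : hom X Y), del Y ∘ f = del X
}.

Arguments copy {m} X.
Arguments del {m} X.

Section Markov.

Variable C : markov_category.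
Implicit Types A B K W X Y : C.

Definition marg_l A X Y (f : hom A (X ⊗ Y)) : hom A X :=
  runit X ∘ (idm X ⊗₁ del Y) ∘ f.

Definition marg_r A X Y (f : hom A (X ⊗ Y)) : hom A Y :=
  lunit Y ∘ (del X ⊗₁ idm Y) ∘ f.

Definition is_conditional A X Y (f : hom A (X ⊗ Y)) (c : hom (X ⊗ A) Y) : Prop :=
  f = (idm X ⊗₁ c) ∘ assoc X X A ∘ (copy X ⊗₁ idm A)
        ∘ (marg_l f ⊗₁ idm A) ∘ copy A.

Definition has_conditionals : Prop :=
  forall A X Y (f : hom A (X ⊗ Y)), exists c : hom (X ⊗ A) Y, is_conditional f c.

Definition as_eq A X W Y (p : hom A X) (f1 f2 : hom (W ⊗ X) Y) : Prop :=
  (f1 ⊗₁ idm X) ∘ assoc_inv W X X ∘ (idm W ⊗₁ (copy X ∘ p))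
  = (f2 ⊗₁ idm X) ∘ assoc_inv W X X ∘ (idm W ⊗₁ (copy X ∘ p)).

Definition abs_cont A B X (p : hom A X) (q : hom B X) : Prop :=
  forall W Y (f1 f2 : hom (W ⊗ X) Y), as_eq q f1 f2 -> as_eq p f1 f2.

Definition atomic_mor A X (p : hom A X) : Prop :=
  abs_cont (copy X ∘ p) (p ⊗₁ p).

Definition atomic : Prop := forall A X (p : hom A X), atomic_mor p.

Definition cancellable W : Prop :=
  forall X Y (f1 f2 : hom X Y), del W ⊗₁ f1 = del W ⊗₁ f2 -> f1 = f2.

Definition cancellative : Prop := forall W, cancellable W.

(* Non-signalling from the second input W' to the second output W. *)
Definition non_signalling X W' Y W (f : hom (X ⊗ W') (Y ⊗ W)) : Prop :=
  exists fs : hom X W, marg_r f = runit W ∘ (fs ⊗₁ del W').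

Record comb A A' B B' := Comb {
  comb_mem : C;
  comb_fst : hom A (comb_mem ⊗ B);
  comb_snd : hom (comb_mem ⊗ B') A'
}.

Definition insertion A A' B B' (c : comb A A' B B') K K'
    (h : hom (B ⊗ K) (B' ⊗ K')) : hom (A ⊗ K) (A' ⊗ K') :=
  (comb_snd c ⊗₁ idm K') ∘ assoc_inv (comb_mem c) B' K'
  ∘ (idm (comb_mem c) ⊗₁ h)
  ∘ assoc (comb_mem c) B K ∘ (comb_fst c ⊗₁ idm K).

Definition extension A A' B B' (c : comb A A' B B') : hom (A ⊗ B') (A' ⊗ B) :=
  insertion c (swap B B').

Definition ext_equiv A A' B B' (c1 c2 : comb A A' B B') : Prop :=
  extension c1 = extension c2.

Definition ctx_equiv A A' B B' (c1 c2 : comb A A' B B') : Prop :=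
  forall K K' (h : hom (B ⊗ K) (B' ⊗ K')), insertion c1 h = insertion c2 h.

(* The quotient by contextual equivalence: subsets of combs that are a class.
   Equality of such subsets is extensional only up to functional and
   propositional extensionality. *)
Definition ctx_class A A' B B' : Type :=
  {P : comb A A' B B' -> Prop | exists c, P = ctx_equiv c}.

Definition class_of A A' B B' (c : comb A A' B B') : ctx_class A A' B B' :=
  exist _ (ctx_equiv c) (ex_intro _ c erefl).

Definition ns_hom A A' B B' : Type :=
  {f : hom (A ⊗ B') (A' ⊗ B) | non_signalling f}.

End Markov.

(* Main.v *)
(* Diagrams are computed with pairs <f, g> = (f ⊗ g) ∘ copy and projections.  The
   rules of a cartesian category hold, except that <f, g> ∘ d = <f ∘ d, g ∘ d> needs
   d to be deterministic; the coherence isomorphisms and the copy maps are.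

   A conditional of the first half of a comb given its B-output puts the comb in the
   form: draw b from p(a), feed (b, a) and the returned b' to a kernel k.  The extension
   has B-marginal p ⊗ del, so by cancellativity it determines p; copying a and b' along,
   it determines k at (b, a, b') for almost every b and every b' not depending on b.  In
   an insertion b' is computed from b.  If b' is computed from an independent copy of b
   instead, the two kernels still agree, and atomicity lets the copies be identified.
   Conversely, a conditional on B turns a non-signalling morphism into such a comb. *)

Require Import Defs.
From mathcomp Require Import ssreflect ssrfun.
From Stdlib Require Import IndefiniteDescription FunctionalExtensionality.
From Stdlib Require Import PropExtensionality ProofIrrelevance.

Set Implicit Arguments.
Unset Strict Implicit.
Unset Printing Implicit Defensive.

Local Open Scope cat_scope.

Local Notation compA := Defs.compA.

(** * Calculus of pairings and projections *)

Section Pairing.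

Variable C : markov_category.
Implicit Types A B D K W X Y Z : C.

(* Locked, since rewriting with [compA] would otherwise look inside. *)
Fact pair_key : unit. Proof. exact: tt. Qed.
Definition pr1 X Y : hom (X ⊗ Y) X :=
  locked_with pair_key (runit X ∘ (idm X ⊗₁ del Y)).
Definition pr2 X Y : hom (X ⊗ Y) Y :=
  locked_with pair_key (lunit Y ∘ (del X ⊗₁ idm Y)).
Definition pair A X Y (f : hom A X) (g : hom A Y) : hom A (X ⊗ Y) :=
  locked_with pair_key ((f ⊗₁ g) ∘ copy A).

Local Notation "⟨ f , g ⟩" := (pair f g) (at level 0) : cat_scope.
Local Notation π1 := (pr1 _ _).
Local Notation π2 := (pr2 _ _).

Lemma pr1_def X Y : π1 = runit X ∘ (idm X ⊗₁ del Y).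
Proof. by rewrite /pr1 unlock. Qed.

Lemma pr2_def X Y : π2 = lunit Y ∘ (del X ⊗₁ idm Y).
Proof. by rewrite /pr2 unlock. Qed.

Lemma pair_def A X Y (f : hom A X) (g : hom A Y) : ⟨f, g⟩ = (f ⊗₁ g) ∘ copy A.
Proof. by rewrite /pair unlock. Qed.

Definition det A X (d : hom A X) : Prop := copy X ∘ d = ⟨d, d⟩.

Lemma tensor_pair A X Y X' Y' (f : hom X X') (g : hom Y Y')
    (h : hom A X) (k : hom A Y) :
  (f ⊗₁ g) ∘ ⟨h, k⟩ = ⟨f ∘ h, g ∘ k⟩.
Proof. by rewrite !pair_def compA -tensorm_comp. Qed.

Lemma swap_pair A X Y (f : hom A X) (g : hom A Y) : swap X Y ∘ ⟨f, g⟩ = ⟨g, f⟩.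
Proof. by rewrite !pair_def compA swap_nat -compA copyC. Qed.

Lemma assoc_pair A X Y Z (f : hom A X) (g : hom A Y) (h : hom A Z) :
  assoc X Y Z ∘ ⟨⟨f, g⟩, h⟩ = ⟨f, ⟨g, h⟩⟩.
Proof.
have -> : ⟨⟨f, g⟩, h⟩ = ((f ⊗₁ g) ⊗₁ h) ∘ ((copy A ⊗₁ idm A) ∘ copy A).
  by rewrite !pair_def compA -tensorm_comp compm1.
rewrite !pair_def compA assoc_nat -!compA (compA (assoc _ _ _)) copyA.
by rewrite compA -tensorm_comp compm1.
Qed.

Lemma assoc_inv_pair A X Y Z (f : hom A X) (g : hom A Y) (h : hom A Z) :
  assoc_inv X Y Z ∘ ⟨f, ⟨g, h⟩⟩ = ⟨⟨f, g⟩, h⟩.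
Proof. by rewrite -assoc_pair compA assocK comp1m. Qed.

Lemma pr1_tensor X Y X' Y' (f : hom X X') (g : hom Y Y') :
  π1 ∘ (f ⊗₁ g) = f ∘ π1.
Proof.
by rewrite !pr1_def -compA -tensorm_comp del_nat comp1m compA -runit_nat -compA
  -tensorm_comp compm1 comp1m.
Qed.

Lemma pr2_tensor X Y X' Y' (f : hom X X') (g : hom Y Y') :
  π2 ∘ (f ⊗₁ g) = g ∘ π2.
Proof.
by rewrite !pr2_def -compA -tensorm_comp del_nat comp1m compA -lunit_nat -compA
  -tensorm_comp compm1 comp1m.
Qed.

Lemma pr1_pair A X Y (f : hom A X) (g : hom A Y) : π1 ∘ ⟨f, g⟩ = f.
Proof. by rewrite pair_def compA pr1_tensor -compA pr1_def copy_delr compm1. Qed.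

Lemma pr2_pair A X Y (f : hom A X) (g : hom A Y) : π2 ∘ ⟨f, g⟩ = g.
Proof. by rewrite !pair_def compA pr2_tensor -compA pr2_def copy_dell compm1. Qed.

Definition pairE :=
  (tensor_pair, swap_pair, assoc_pair, assoc_inv_pair, pr1_pair, pr2_pair,
   @comp1m C, @compm1 C).

(** * Deterministic morphisms *)

Lemma det_id X : det (idm X).
Proof. by rewrite /det !pair_def tensorm1 comp1m compm1. Qed.

Lemma pair_det A X Y Z (d : hom A X) (f : hom X Y) (g : hom X Z) :
  det d -> ⟨f, g⟩ ∘ d = ⟨f ∘ d, g ∘ d⟩.
Proof. by move=> dd; rewrite -tensor_pair -dd pair_def compA. Qed.

Lemma det_comp A X Y (e : hom X Y) (d : hom A X) : det e -> det d -> det (e ∘ d).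
Proof. by move=> de dd; rewrite /det compA de pair_det. Qed.

Lemma det_pair A X Y (d : hom A X) (e : hom A Y) : det d -> det e -> det ⟨d, e⟩.
Proof.
move=> dd de; rewrite /det copy_tensor -compA tensor_pair dd de /middle_swap.
by rewrite !(pairE, =^~ compA).
Qed.

(** [unitob] is terminal by [del_nat] and [del_unit], and [unitob ⊗ unitob] is isomorphic to it. *)
Lemma unit_terminal A (f g : hom A (unitob ⊗ unitob : C)) : f = g.
Proof.
rewrite -[f]comp1m -[g]comp1m -lunitK -!compA; congr (_ ∘ _).
by rewrite -[LHS]comp1m -[RHS]comp1m -del_unit !del_nat.
Qed.

(** Meant for the unitors, whose inverses are pairings of deterministic maps. *)
Lemma det_inverse X Y (d : hom X Y) (e : hom Y X) :
  e ∘ d = idm X -> d ∘ e = idm Y -> det e -> det d.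
Proof.
move=> ed de dete.
rewrite /det pair_def -[LHS]comp1m -tensorm1 -!de tensorm_comp -compA (compA _ (copy Y)).
have <- : copy X ∘ e = (e ⊗₁ e) ∘ copy Y by rewrite dete pair_def.
by rewrite -(compA (copy X)) ed compm1.
Qed.

Lemma lunit_invE X : lunit_inv X = ⟨del X, idm X⟩.
Proof.
by rewrite -[RHS]comp1m -lunitK -compA pair_def (compA (lunit _)) copy_dell compm1.
Qed.

Lemma runit_invE X : runit_inv X = ⟨idm X, del X⟩.
Proof.
by rewrite -[RHS]comp1m -runitK -compA !pair_def (compA (runit _)) copy_delr compm1.
Qed.

Lemma det_del X : det (del X).
Proof. exact: unit_terminal. Qed.

Lemma det_lunit X : det (lunit X).
Proof.
apply: det_inverse (lunitK X) (lunit_invK X) _; rewrite lunit_invE.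
exact: det_pair (det_del X) (det_id X).
Qed.

Lemma det_runit X : det (runit X).
Proof.
apply: det_inverse (runitK X) (runit_invK X) _; rewrite runit_invE.
exact: det_pair (det_id X) (det_del X).
Qed.

(** [middle_swap] for four distinct objects, so that naturality can be stated. *)
Definition interchange W X Y Z : hom ((W ⊗ X) ⊗ (Y ⊗ Z)) ((W ⊗ Y) ⊗ (X ⊗ Z)) :=
  assoc_inv W Y (X ⊗ Z)
  ∘ (idm W ⊗₁ (assoc Y X Z ∘ (swap X Y ⊗₁ idm Z) ∘ assoc_inv X Y Z))
  ∘ assoc W X (Y ⊗ Z).

Lemma assoc_inv_nat X X' Y Y' Z Z' (f : hom X X') (g : hom Y Y') (h : hom Z Z') :
  assoc_inv X' Y' Z' ∘ (f ⊗₁ (g ⊗₁ h)) = ((f ⊗₁ g) ⊗₁ h) ∘ assoc_inv X Y Z.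
Proof.
by rewrite -[LHS]compm1 -assoc_invK compA -(compA _ _ (assoc _ _ _)) -assoc_nat
  compA assocK comp1m.
Qed.

Lemma interchange_nat W X Y Z W' X' Y' Z' (f : hom W W') (g : hom X X')
    (h : hom Y Y') (k : hom Z Z') :
  interchange W' X' Y' Z' ∘ ((f ⊗₁ g) ⊗₁ (h ⊗₁ k))
  = ((f ⊗₁ h) ⊗₁ (g ⊗₁ k)) ∘ interchange W X Y Z.
Proof.
have sw : (swap X' Y' ⊗₁ idm Z') ∘ ((g ⊗₁ h) ⊗₁ k)
    = ((h ⊗₁ g) ⊗₁ k) ∘ (swap X Y ⊗₁ idm Z).
  by rewrite -!tensorm_comp swap_nat comp1m compm1.
rewrite /interchange -compA assoc_nat compA -(compA _ _ (f ⊗₁ _)) -tensorm_comp.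
rewrite -(compA _ _ (g ⊗₁ _)) assoc_inv_nat compA -(compA _ _ ((g ⊗₁ h) ⊗₁ _)) sw.
rewrite compA assoc_nat comp1m -[f in LHS]compm1 -!(compA (h ⊗₁ _)) tensorm_comp.
by rewrite compA assoc_inv_nat !compA.
Qed.

Lemma det_tensor X Y X' Y' (d : hom X X') (e : hom Y Y') :
  det d -> det e -> det (d ⊗₁ e).
Proof.
move=> dd de; rewrite /det !pair_def !copy_tensor -compA -tensorm_comp dd de.
rewrite !pair_def tensorm_comp compA [X in _ = X]compA; congr (_ ∘ _).
exact: interchange_nat.
Qed.

Lemma det_pr1 X Y : det (pr1 X Y).
Proof.
rewrite pr1_def; exact: det_comp (det_runit X) (det_tensor (det_id X) (det_del Y)).
Qed.

Lemma det_pr2 X Y : det (pr2 X Y).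
Proof.
rewrite pr2_def; exact: det_comp (det_lunit Y) (det_tensor (det_del X) (det_id Y)).
Qed.

Lemma pair_pr X Y : ⟨π1, π2⟩ = idm (X ⊗ Y).
Proof.
have ms : ((idm X ⊗₁ del Y) ⊗₁ (del X ⊗₁ idm Y)) ∘ middle_swap X Y
    = (idm X ⊗₁ del X) ⊗₁ (del Y ⊗₁ idm Y).
  rewrite -[LHS](interchange_nat (idm X) (del X) (del Y) (idm Y)) /interchange.
  (* The two middle wires are deleted, and on [unitob ⊗ unitob] the swap is the identity. *)
  rewrite (unit_terminal (swap _ _) (idm _)) tensorm1 compm1 assoc_invK tensorm1.
  by rewrite compm1 assocK comp1m.
rewrite !pair_def pr1_def pr2_def copy_tensor tensorm_comp compA.
rewrite -(compA _ _ (middle_swap X Y)).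
by rewrite ms -!tensorm_comp copy_delr copy_dell tensorm1.
Qed.

Lemma tensorE X Y X' Y' (f : hom X X') (g : hom Y Y') :
  f ⊗₁ g = ⟨f ∘ π1, g ∘ π2⟩.
Proof. by rewrite -tensor_pair pair_pr compm1. Qed.

Lemma pair_prE X Y Z (d : hom Z (X ⊗ Y)) : det d -> ⟨π1 ∘ d, π2 ∘ d⟩ = d.
Proof. by move=> dd; rewrite -pair_det // pair_pr comp1m. Qed.

Lemma tensor_comp_idr K X Y Z (g : hom Y Z) (f : hom X Y) :
  (g ∘ f) ⊗₁ idm K = (g ⊗₁ idm K) ∘ (f ⊗₁ idm K).
Proof. by rewrite -tensorm_comp comp1m. Qed.

Lemma copyE X : copy X = ⟨idm X, idm X⟩.
Proof. by rewrite !pair_def tensorm1 comp1m. Qed.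

(** * Normalization of diagrams *)

Ltac prove_det := repeat first
  [ assumption | exact: det_id | exact: det_pr1 | exact: det_pr2
  | apply: det_pair | apply: det_comp ].

(** Precomposition with a random map need not distribute over a pairing, so each rewrite is guarded
    by [prove_det]. *)
Ltac push_det := repeat match goal with
  |- context [compm (pair ?f ?g) ?d] =>
    rewrite (@pair_det _ _ _ _ d f g ltac:(solve [prove_det]))
  | |- context [pair (compm (pr1 _ _) ?d) (compm (pr2 _ _) ?d)] =>
    rewrite (@pair_prE _ _ _ d ltac:(solve [prove_det]))
  end.

Ltac normalize := repeat progress (rewrite ?(pairE, pair_pr, =^~ compA); push_det).

Lemma swapE X Y : swap X Y = ⟨π2, π1⟩.
Proof. by rewrite -[LHS]compm1 -pair_pr swap_pair. Qed.

Lemma assocE X Y Z : assoc X Y Z = ⟨π1 ∘ π1, ⟨π2 ∘ π1, π2⟩⟩.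
Proof.
by rewrite -[LHS]compm1 -pair_pr -[π1 in LHS]pair_prE ?assoc_pair; prove_det.
Qed.

Lemma assoc_invE X Y Z : assoc_inv X Y Z = ⟨⟨π1, π1 ∘ π2⟩, π2 ∘ π2⟩.
Proof.
by rewrite -[LHS]compm1 -pair_pr -[π2 in LHS]pair_prE ?assoc_inv_pair; prove_det.
Qed.

Lemma tensor_copy A X Y (f : hom A X) (g : hom A Y) : (f ⊗₁ g) ∘ copy A = ⟨f, g⟩.
Proof. by rewrite copyE tensor_pair !compm1. Qed.

(** * Conditionals and normal forms of combs *)

Lemma marg_lE A X Y (f : hom A (X ⊗ Y)) : marg_l f = π1 ∘ f.
Proof. by rewrite pr1_def. Qed.

Lemma marg_rE A X Y (f : hom A (X ⊗ Y)) : marg_r f = π2 ∘ f.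
Proof. by rewrite pr2_def. Qed.

Lemma conditionalE A X Y (f : hom A (X ⊗ Y)) (c : hom (X ⊗ A) Y) :
  is_conditional f c -> f = ⟨π1, c⟩ ∘ ⟨π1 ∘ f, idm A⟩.
Proof.
rewrite /is_conditional -[X in _ = X]compA tensor_copy marg_lE => {1}->.
by congr (_ ∘ _); rewrite (tensorE (copy X)) copyE; normalize.
Qed.

(** The memory map [e] slides past [h] and merges into [comb_snd c]; combs with the same [q] and [b]
    then differ only in their kernels. *)
Lemma insertion_pair A A' B B' (c : comb A A' B B') X (q : hom A X)
    (e : hom X (comb_mem c)) (b : hom X B) K K' (h : hom (B ⊗ K) (B' ⊗ K')) :
  comb_fst c = ⟨e, b⟩ ∘ q ->
  insertion c h
  = ((comb_snd c ∘ (e ⊗₁ idm B')) ⊗₁ idm K') ∘ assoc_inv X B' K'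
      ∘ ⟨π1, h ∘ ⟨b ∘ π1, π2⟩⟩ ∘ (q ⊗₁ idm K).
Proof.
move=> cq; rewrite /insertion cq !tensor_comp_idr compA; congr (_ ∘ _).
rewrite -(compA _ _ (assoc_inv _ _ _)) -assoc_inv_nat tensorm1.
by rewrite (tensorE ⟨e, b⟩); normalize.
Qed.

(** Both [p] and [d] may be random: by associativity of copying, [d] can run after [p] on the
    retained input. *)
Lemma pair_let A X Y (p : hom A X) (d : hom A Y) :
  ⟨⟨p, idm A⟩, d⟩ = ⟨idm _, d ∘ π2⟩ ∘ ⟨p, idm A⟩.
Proof.
have -> : ⟨idm (X ⊗ A), d ∘ π2⟩
    = assoc_inv X A Y ∘ (idm X ⊗₁ ⟨idm A, d⟩).
  by rewrite (tensorE (idm X)); normalize.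
by normalize.
Qed.

Lemma extension_pair A A' B B' (c : comb A A' B B') X (q : hom A (B ⊗ X))
    (e : hom (B ⊗ X) (comb_mem c)) :
  comb_fst c = ⟨e, π1⟩ ∘ q ->
  extension c
  = ⟨comb_snd c ∘ (e ⊗₁ idm B'), π1 ∘ π1⟩ ∘ (q ⊗₁ idm B').
Proof.
move=> cq; rewrite /extension (insertion_pair _ cq); congr (_ ∘ _).
by normalize; rewrite (tensorE e) comp1m.
Qed.

(** Discarding the output in [A'] also discards [comb_snd c], the only place where the input in [B']
    is used. *)
Lemma marg_r_extension A A' B B' (c : comb A A' B B') :
  marg_r (extension c) = marg_r (comb_fst c) ∘ π1.
Proof.
rewrite !marg_rE /extension /insertion !compA pr2_tensor comp1m.
rewrite -(compA π2 _ π1) -(pr1_tensor _ (idm B')).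
by rewrite compA; congr (_ ∘ _); rewrite assocE assoc_invE (tensorE (idm _)); normalize.
Qed.

Lemma non_signalling_extension A A' B B' (c : comb A A' B B') :
  non_signalling (extension c).
Proof.
exists (marg_r (comb_fst c)).
by rewrite marg_r_extension pr1_def compA -runit_nat -compA -tensorm_comp compm1
  comp1m.
Qed.

(** The memory is conditioned on the [B]-output; [swap] puts that output first, where
    [is_conditional] expects it. *)
Lemma comb_fst_pair A A' B B' (c : comb A A' B B') : has_conditionals C ->
  exists e, comb_fst c = ⟨e, π1⟩ ∘ ⟨marg_r (comb_fst c), idm A⟩.
Proof.
move=> hc; have [e /conditionalE ce] := hc _ _ _ (swap _ _ ∘ comb_fst c).
have pr1_swap : π1 ∘ swap (comb_mem c) B = π2.
  by rewrite swapE pr1_pair.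
exists e; rewrite -swap_pair -compA marg_rE -pr1_swap -compA -ce compA swapK.
by rewrite comp1m.
Qed.

(** * Almost-sure equality *)

Lemma as_eqE A X W Y (p : hom A X) (f1 f2 : hom (W ⊗ X) Y) :
  as_eq p f1 f2 <-> ⟨f1, π2⟩ ∘ (idm W ⊗₁ p) = ⟨f2, π2⟩ ∘ (idm W ⊗₁ p).
Proof.
have E f : (f ⊗₁ idm X) ∘ assoc_inv W X X ∘ (idm W ⊗₁ (copy X ∘ p))
    = ⟨f, π2⟩ ∘ (idm W ⊗₁ p) :> hom _ (Y ⊗ X).
  rewrite -[idm W in LHS]comp1m tensorm_comp compA; congr (_ ∘ _).
  by rewrite copyE (tensorE (idm W)); normalize.
by rewrite /as_eq !E.
Qed.

Lemma pair_id_tensor A B K (p : hom A B) :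
  ⟨p, idm A⟩ ⊗₁ idm K = assoc_inv B A K ∘ ⟨p ∘ π1, idm _⟩.
Proof. by rewrite tensorE -[idm (A ⊗ K)]pair_pr; normalize. Qed.

(** Beside the output of the kernel the extension shows only b, but a and b' are inputs and can be
    copied along. *)
Lemma ae_of_extension A A' B B' (p : hom A B) (k1 k2 : hom ((B ⊗ A) ⊗ B') A') :
  ⟨k1, π1 ∘ π1⟩ ∘ (⟨p, idm A⟩ ⊗₁ idm B') = ⟨k2, π1 ∘ π1⟩ ∘ (⟨p, idm A⟩ ⊗₁ idm B') ->
  ⟨k1, idm _⟩ ∘ (⟨p, idm A⟩ ⊗₁ idm B') = ⟨k2, idm _⟩ ∘ (⟨p, idm A⟩ ⊗₁ idm B').
Proof.
set q := ⟨p, idm A⟩ ⊗₁ idm B' => kq.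
have qE : q = assoc_inv B A B' ∘ ⟨p ∘ π1, idm _⟩ by exact: pair_id_tensor.
have let_q : ⟨q, idm _⟩ = ⟨idm _, ⟨π2 ∘ π1, π2⟩⟩ ∘ q.
  rewrite {1}qE -[X in ⟨_, X⟩]comp1m -tensor_pair pair_let qE.
  by rewrite !compA; congr (_ ∘ _); rewrite assoc_invE; normalize.
suff E k : ⟨k, idm _⟩ ∘ q = (idm A' ⊗₁ assoc_inv B A B') ∘ assoc _ _ _
    ∘ ⟨⟨k, π1 ∘ π1⟩ ∘ q, idm _⟩ by rewrite !E kq.
rewrite -[X in ⟨_ ∘ q, X⟩]comp1m -[in RHS]tensor_pair let_q !compA; congr (_ ∘ _).
by normalize.
Qed.

Lemma interchange_pair A W X Y Z (f : hom A W) (g : hom A X) (h : hom A Y)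
    (k : hom A Z) :
  interchange W X Y Z ∘ ⟨⟨f, g⟩, ⟨h, k⟩⟩ = ⟨⟨f, h⟩, ⟨g, k⟩⟩.
Proof. by rewrite /interchange; normalize. Qed.

(** Since [f] may be random, [pair_det] does not apply to [⟨f, g⟩]; coherence maps replace it. *)
Lemma pair_dup W X Y Z (f : hom W X) (g : hom W Y) (d : hom Y Z) :
  det d -> det g -> ⟨⟨d ∘ g, f⟩, g⟩ = ⟨⟨d ∘ π2, π1⟩, π2⟩ ∘ ⟨f, g⟩.
Proof.
move=> dd dg.
have -> : ⟨⟨d ∘ π2, π1⟩, π2⟩ = assoc_inv Z X Y
    ∘ (swap _ _ ∘ (assoc_inv X Y Z ∘ (idm X ⊗₁ ⟨idm Y, d⟩))).
  by rewrite (tensorE (idm X)); normalize.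
by normalize.
Qed.

Lemma ae_plug A X Y B' K K' (q : hom A X) (k1 k2 : hom (X ⊗ B') Y)
    (h : hom (X ⊗ K) (B' ⊗ K')) : atomic_mor q ->
  ⟨k1, idm _⟩ ∘ (q ⊗₁ idm B') = ⟨k2, idm _⟩ ∘ (q ⊗₁ idm B') ->
  (k1 ⊗₁ idm K') ∘ assoc_inv X B' K' ∘ ⟨π1, h⟩ ∘ (q ⊗₁ idm K)
  = (k2 ⊗₁ idm K') ∘ assoc_inv X B' K' ∘ ⟨π1, h⟩ ∘ (q ⊗₁ idm K).
Proof.
move=> atq kq.
(* [k] is evaluated at the second copy of [x], its input in [B'] comes from the first. *)
pose F k : hom (K ⊗ (X ⊗ X)) (Y ⊗ K') :=
  (k ⊗₁ idm K') ∘ (assoc_inv X B' K' ∘ ⟨π2 ∘ π2, h ∘ ⟨π1 ∘ π2, π1⟩⟩).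
(* On a copied draw [F k] is the composite in the goal; atomicity reduces the claim to independent
   draws. *)
suff /atq/as_eqE : as_eq (q ⊗₁ q) (F k1) (F k2).
  move=> /(congr1 (fun f => π1 ∘ f ∘ swap A K)).
  have E k : π1 ∘ (⟨F k, π2⟩ ∘ idm K ⊗₁ (copy X ∘ q)) ∘ swap A K
    = (k ⊗₁ idm K') ∘ assoc_inv X B' K' ∘ ⟨π1, h⟩ ∘ (q ⊗₁ idm K).
    rewrite compA pr1_pair -compA.
    have -> : (idm K ⊗₁ (copy X ∘ q)) ∘ swap A K
        = ⟨π2, ⟨π1, π1⟩⟩ ∘ (q ⊗₁ idm K).
      rewrite -swap_nat tensor_comp_idr compA; congr (_ ∘ _).
      by rewrite copyE tensorE swapE; normalize.
    by rewrite compA; congr (_ ∘ _); rewrite /F -!compA; normalize.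
  by rewrite !E.
(* [plug] computes b' from the first draw, and [perm] puts the second draw beside it. [Z] is [A]
   before the second [q] acts and [X] after; naturality in [Z] delays that [q] until just before
   [k]. *)
pose plug Z : hom (K ⊗ (X ⊗ Z)) ((B' ⊗ K') ⊗ (X ⊗ Z)) := ⟨h ∘ ⟨π1 ∘ π2, π1⟩, π2⟩.
pose perm Z : hom ((B' ⊗ K') ⊗ (X ⊗ Z)) ((Z ⊗ B') ⊗ (K' ⊗ X)) :=
  ⟨⟨π2 ∘ π2, π1 ∘ π1⟩, ⟨π2 ∘ π1, π1 ∘ π2⟩⟩.
have plug_nat : plug X ∘ (idm K ⊗₁ (idm X ⊗₁ q)) = (idm _ ⊗₁ (idm X ⊗₁ q)) ∘ plug A.
  (* As [h] may be random, naturality needs a form in which [q] acts on a separate tensor factor. *)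
  have plugE Z : plug Z = assoc _ _ _ ∘ (⟨h ∘ ⟨π2, π1⟩, π2⟩ ⊗₁ idm Z)
      ∘ assoc_inv _ _ _.
    by rewrite tensorE assoc_invE; normalize.
  rewrite !plugE -compA assoc_inv_nat compA -(compA _ (_ ⊗₁ idm X)).
  rewrite -tensorm_comp tensorm1 compm1 comp1m.
  rewrite -[X in X ⊗₁ q]comp1m -[X in _ ⊗₁ X]compm1 tensorm_comp -tensorm1 compA.
  by rewrite assoc_nat !compA.
have perm_nat : perm X ∘ (idm _ ⊗₁ (idm X ⊗₁ q)) = ((q ⊗₁ idm B') ⊗₁ idm _) ∘ perm A.
  have permE Z : perm Z
      = (swap _ _ ⊗₁ idm _) ∘ interchange _ _ _ _ ∘ (idm _ ⊗₁ swap _ _).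
    rewrite -[RHS]compm1 -(pair_pr (B' ⊗ K')) -[RHS]compA tensor_pair comp1m.
    rewrite (swapE X Z) pair_det; last exact: det_pr2.
    rewrite -[in RHS](pair_prE (det_pr1 (B' ⊗ K') (X ⊗ Z))).
    by rewrite -[RHS]compA interchange_pair; normalize.
  rewrite !permE -[LHS]compA -tensorm_comp swap_nat tensorm_comp compA.
  rewrite -[idm (B' ⊗ K')]tensorm1 -(compA _ (interchange _ _ _ _)) interchange_nat.
  by rewrite compA -tensorm_comp swap_nat tensorm_comp !tensorm1 !compA.
(* [as_eq] keeps both draws in the output; the second is recovered from the arguments kept in
   [⟨k, idm _⟩]. *)
pose restore : hom ((Y ⊗ (X ⊗ B')) ⊗ (K' ⊗ X)) ((Y ⊗ K') ⊗ (X ⊗ X)) :=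
  assoc_inv _ _ _ ∘ (idm Y ⊗₁ ⟨π1 ∘ π2, ⟨π2 ∘ π2, π1 ∘ π1⟩⟩) ∘ assoc _ _ _.
have FE k : ⟨F k, π2⟩ = restore ∘ (⟨k, idm _⟩ ⊗₁ idm _) ∘ perm X ∘ plug X.
  have FE' : ⟨F k, π2⟩
      = ⟨(k ⊗₁ idm K') ∘ (assoc_inv X B' K' ∘ ⟨π2 ∘ π2, π1⟩), π2⟩ ∘ plug X.
    rewrite /F compA -[X in ⟨_, X⟩]comp1m -tensor_pair pair_dup; try exact: det_pr2.
    by rewrite compA tensor_pair comp1m -compA.
  rewrite FE'; congr (_ ∘ _).
  rewrite -[in LHS](pair_prE (det_pr1 (B' ⊗ K') (X ⊗ X))) assoc_inv_pair.
  by rewrite /restore /perm; normalize.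
suff E k : ⟨F k, π2⟩ ∘ (idm K ⊗₁ (q ⊗₁ q))
   = restore ∘ ((⟨k, idm _⟩ ∘ (q ⊗₁ idm B')) ⊗₁ idm _) ∘ perm A ∘ plug A
     ∘ (idm K ⊗₁ (q ⊗₁ idm A)).
  by apply/as_eqE; rewrite !E kq.
have -> : idm K ⊗₁ (q ⊗₁ q) = (idm K ⊗₁ (idm X ⊗₁ q)) ∘ (idm K ⊗₁ (q ⊗₁ idm A)).
  by rewrite -!tensorm_comp !comp1m compm1.
rewrite compA; congr (_ ∘ _); rewrite FE -compA plug_nat !compA; congr (_ ∘ _).
by rewrite -compA perm_nat tensor_comp_idr !compA.
Qed.

(** * Equivalence and realization of combs *)

(** [cancellable] discards on the left; a swap moves [K] there. *)
Lemma pr1_cancel A K X (f g : hom A X) : cancellable K -> f ∘ pr1 A K = g ∘ π1 -> f = g.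
Proof.
move=> hK fg; apply: hK; rewrite !tensorE.
have E (h : hom A X) : h ∘ pr2 K A = h ∘ π1 ∘ swap K A.
  by rewrite -compA swapE pr1_pair.
by rewrite !E fg.
Qed.

Lemma ext_equiv_ctx_equiv A A' B B' (c1 c2 : comb A A' B B') :
  cancellative C -> atomic C -> has_conditionals C ->
  ext_equiv c1 c2 -> ctx_equiv c1 c2.
Proof.
move=> hcanc hat hcond; rewrite /ext_equiv => ext.
have [e1 c1E] := comb_fst_pair c1 hcond; have [e2 c2E] := comb_fst_pair c2 hcond.
have marg : marg_r (comb_fst c1) = marg_r (comb_fst c2).
  by apply: pr1_cancel (hcanc B') _; rewrite -!marg_r_extension ext.
(* Both combs now start with the same draw, so [ae_plug] can compare their kernels. *)
rewrite -marg in c2E; move: ext.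
rewrite (extension_pair c1E) (extension_pair c2E) => /ae_of_extension ae K K' h.
rewrite (insertion_pair _ c1E) (insertion_pair _ c2E).
exact: ae_plug (hat _ _ _) ae.
Qed.

Lemma non_signalling_comb A A' B B' (f : hom (A ⊗ B') (A' ⊗ B)) :
  has_conditionals C -> non_signalling f ->
  exists c : comb A A' B B', extension c = f.
Proof.
move=> hcond [fs]; have -> : runit B ∘ (fs ⊗₁ del B') = fs ∘ π1.
  by rewrite pr1_def compA -runit_nat -compA -tensorm_comp compm1 comp1m.
rewrite marg_rE => fsE.
have [k /conditionalE] := hcond _ _ _ (swap A' B ∘ f).
rewrite (compA π1) {2}swapE pr1_pair fsE => kE.
(* The memory keeps the drawn b and the input a, which together with b' are the arguments of the
   conditional [k]. *)
pose c := @Comb C A A' B B' (B ⊗ A) (⟨idm _, π1⟩ ∘ ⟨fs, idm A⟩) (k ∘ assoc B A B').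
exists c; rewrite (extension_pair (erefl : comb_fst c = _)) pair_id_tensor /=.
have -> : f = swap B A' ∘ (swap A' B ∘ f) by rewrite compA swapK comp1m.
by rewrite kE !compA; congr (_ ∘ _); rewrite tensorm1 assocE assoc_invE; normalize.
Qed.

End Pairing.

Theorem theorem37 (C : markov_category)
    (hcanc : cancellative C) (hat : atomic C) (hcond : has_conditionals C) :
  (forall (A A' B B' : C) (c1 c2 : comb A A' B B'),
      ext_equiv c1 c2 <-> ctx_equiv c1 c2)
  /\
  (forall A A' B B' : C,
      exists phi : ctx_class A A' B B' -> ns_hom A A' B B',
        (forall c : comb A A' B B', proj1_sig (phi (class_of c)) = extension c)
        /\ bijective phi).
Proof.
have ext_ctx (A A' B B' : C) (c1 c2 : comb A A' B B') :
    ext_equiv c1 c2 <-> ctx_equiv c1 c2.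
  split; first exact: ext_equiv_ctx_equiv.
  (* [extension] is the insertion of a swap, with [B'] and [B] as [K] and [K']. *)
  by move=> ctx; exact: ctx.
split=> // A A' B B'.
have class_eq (x y : ctx_class A A' B B') : proj1_sig x = proj1_sig y -> x = y.
  by apply: eq_sig_hprop => ? ? ?; exact: proof_irrelevance.
have ns_eq (x y : ns_hom A A' B B') : proj1_sig x = proj1_sig y -> x = y.
  by apply: eq_sig_hprop => ? ? ?; exact: proof_irrelevance.
have class_ofE (c1 c2 : comb A A' B B') :
    extension c1 = extension c2 -> class_of c1 = class_of c2.
  move=> e; apply: class_eq; apply: functional_extensionality => c /=.
  apply: propositional_extensionality.
  by split=> /ext_ctx ec; apply/ext_ctx; rewrite /ext_equiv -?ec // e.
have [rep repE] : exists rep : ctx_class A A' B B' -> comb A A' B B',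
    forall x, x = class_of (rep x).
  apply: (functional_choice (fun x c => x = class_of c)) => -[P [c cP]].
  by exists c; exact: class_eq.
have [real realE] : exists real : ns_hom A A' B B' -> comb A A' B B',
    forall f, extension (real f) = proj1_sig f.
  apply: (functional_choice (fun f c => extension c = proj1_sig f)) => -[f hf].
  exact: non_signalling_comb.
(* [phi] goes through chosen representatives; [phiE] shows that the choice is immaterial. *)
pose phi x : ns_hom A A' B B' := exist _ _ (non_signalling_extension (rep x)).
have phiE c : proj1_sig (phi (class_of c)) = extension c.
  apply/esym/ext_ctx; have /(congr1 (@proj1_sig _ _)) /= E := repE (class_of c).
  by rewrite E => K K' h.
(* The inverse sends [f] to the class of a chosen comb with extension [f]. *)
exists phi; split=> //; exists (fun f => class_of (real f)) => [x|f].
  by rewrite {2}[x]repE; apply: class_ofE; rewrite realE.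
by apply: ns_eq; rewrite phiE realE.
Qed.
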